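(* For each of the Kähler, almost Kähler and Spin$^c$ quantizations, the reproducing kernel $K^{(k)}(x,y)=\sum_{j=1}^{d_k}\overline{\theta^{(k)}_j(x)}\otimes\theta^{(k)}_j(y)$ is the unique polarized section of $\overline{L^k}\boxtimes L^k$ over $M\times M$ such that $$\int_M \overline{K^{(k)}(x,y)}\cdot s(y)\,\epsilon_\omega(y)=s(x)\qquad\text{for all } s\in\mathcal H_k \text{ and all } x\in M.$$
   Context: Setting. $(M,\omega)$ is a compact symplectic manifold of dimension $2n$ with $[\omega/2\pi]$ integral; $\ell\to M$ is a Hermitian line bundle with compatible connection $\nabla$ of curvature $-i\omega$; $\ell^{\otimes k}$ carries the induced Hermitian structure $h$ (conjugate linear in the first argument) and connection. $\epsilon_\omega=(2\pi)^{-n}\omega^{\wedge n}/n!$. $J$ is an $\omega$-compatible almost complex structure, $g=\omega(\cdot,J\cdot)$, $TM_{\mathbb C}=TM^{(1,0)}\oplus TM^{(0,1)}$ is the $\pm i$-eigenspace decomposition, and $d_k=\int_M \mathrm{ch}(\ell^{\otimes k})\,\mathrm{Td}(TM^{(1,0)})$. For sections $s_1,s_2$, $\langle s_1|s_2\rangle=\int_M h(s_1,s_2)\,\epsilon_\omega$. Quantizations. The bundle $L^k$ and the quantum Hilbert space $\mathcal H_k\subset L^2(M,L^k)$, with $\dim\mathcal H_k=d_k<\infty$ and consisting of smooth sections, are one of the following. (i) Kähler ($J$ integrable): $L^k=\ell^{\otimes k}$ and $\mathcal H_k$ is the space of sections $s$ with $\nabla_Xs=0$ for all $X\in\Gamma(TM^{(0,1)})$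 (holomorphic sections). (ii) Almost Kähler: $L^k=\ell^{\otimes k}$ and $\mathcal H_k$ is the span of orthonormal eigensections for the first $d_k$ eigenvalues (in nondecreasing order, with multiplicity) of $\Delta_k=\Delta-nk$, where $\Delta$ is the Laplacian on sections of $\ell^{\otimes k}$ for $g$ and $\nabla$. (iii) Spin$^c$: $L^k=\Lambda^{0,*}(T^*M)\otimes\ell^{\otimes k}$ with the Hermitian structure $h$ induced by $g$ and $h$, and $\mathcal H_k=\ker D_+\ominus\ker D_-$, where $D_\pm$ are the even/odd parts of the Spin$^c$ Dirac operator on $L^k$ determined by $(J,g,\nabla)$. Throughout $k$ is large enough that the relevant vanishing/existence theorem holds (in (i), $\dim\mathcal H_k=d_k$; in (ii), with constants $a>0$ and $C$ independent of $k$, the first $d_k$ eigenvalues of $\Delta_k$ lie in $(-a,a)$ and the others lie to the right of $nk+C$; in (iii), $\ker D_-=0$, so $\mathcal H_k=\ker D_+$). Elements of $\mathcal H_k$ are called polarized sections. $\{\theta^{(k)}_j\}_{j=1}^{d_k}$ is any orthonormal basis of $\mathcal H_k$. Conventions. $E_1\boxtimes E_2=\pi_1^*E_1\otimes\pi_2^*E_2$. $\overline{\overline u\otimes v}:=u\otimes\overline v$, and $(u\otimes\overline v)\cdot w:=h(v,w)\,u$; hence $\overline{K^{(k)}(x,y)}\cdot s(y)=\sum_j h(\theta^{(k)}_j(y),s(y))\,\theta^{(k)}_j(x)$. A polarized section of $\overline{L^k}\boxtimes L^k$ is an element of $\overline{\mathcal H_k}\otimes\mathcal H_k$, i.e. a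 finite linear combination of sections $(x,y)\mapsto\overline{s_1(x)}\otimes s_2(y)$ with $s_1,s_2\in\mathcal H_k$. *)

(* Defs.v *)
From HB Require Import structures.
From mathcomp Require Import all_boot all_order all_algebra all_fingroup.
From mathcomp Require Import all_classical all_reals all_analysis.
From mathcomp Require Import complex.
Set Implicit Arguments.
Unset Strict Implicit.
Unset Printing Implicit Defensive.
Import Order.TTheory GRing.Theory Num.Theory numFieldNormedType.Exports.
Local Open Scope classical_set_scope.
Local Open Scope ring_scope.

(* Everything is expressed in local coordinates.  A tangent vector is a column
   'cV_m, a covector a row 'rV_m, an endomorphism J of the tangent space the
   matrix with J d_b = \sum_a (J a b) d_a, and a bilinear form w the matrix
   w a b = w(d_a, d_b), where d_a is the a-th coordinate vector field. *)

(* A (mixed degree) exterior form is the family of its coefficients on the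
   basis dx^S = dx^s1 /\ ... /\ dx^sp, S = {s1 < ... < sp}; note that the
   sequence enum S is increasing. *)
Section ExteriorAlgebra.
Context {K : comNzRingType} {m : nat}.

Definition form := {ffun {set 'I_m} -> K^o}.

Definition form1 : form := [ffun S => (S == finset.set0)%:R].

Definition esign (S : {set 'I_m}) (a : 'I_m) : K :=
  (-1) ^+ #|[set b in S | (b < a)%N]|.

(* dx^a /\ eta *)
Definition ext1 (a : 'I_m) (eta : form) : form :=
  [ffun S : {set 'I_m} =>
     if a \in S then esign S a * eta (S :\ a)%SET else 0].

(* contraction of eta with d_a *)
Definition int1 (a : 'I_m) (eta : form) : form :=
  [ffun S : {set 'I_m} =>
     if a \in S then 0 else esign S a * eta (a |: S)%SET].

Definition ext (c : 'rV[K]_m) (eta : form) : form :=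
  \sum_a c ord0 a *: ext1 a eta.

Definition int (v : 'cV[K]_m) (eta : form) : form :=
  \sum_a v a ord0 *: int1 a eta.

Definition wedge (eta zeta : form) : form :=
  \sum_(S : {set 'I_m}) eta S *: foldr ext1 zeta (enum S).

Definition wpow (j : nat) (eta : form) : form := iter j (wedge eta) form1.

(* substitution dx^a := \sum_b (D a b) dx^b *)
Definition pull (D : 'M[K]_m) (eta : form) : form :=
  \sum_(S : {set 'I_m})
    eta S *: foldr (fun a => ext (row a D)) form1 (enum S).

(* the 2-form \sum_(a < b) W(d_a, d_b) dx^a /\ dx^b *)
Definition form2 (W : 'I_m -> 'I_m -> K) : form :=
  \sum_(a < m) \sum_(b < m | (a < b)%N) W a b *: ext1 a (ext1 b form1).

Definition top (eta : form) : K := eta [set: 'I_m]%SET.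

(* matrices with entries in the exterior algebra *)
Definition wmul (X Y : 'M[form]_m) : 'M[form]_m :=
  \matrix_(p, q) \sum_l wedge (X p l) (Y l q).

Definition wone : 'M[form]_m := \matrix_(p, q) (if p == q then form1 else 0).

Definition wmpow (j : nat) (X : 'M[form]_m) : 'M[form]_m :=
  iter j (wmul X) wone.

(* only used when the entries are forms of even degree, which commute *)
Definition wdet (X : 'M[form]_m) : form :=
  \sum_(s : 'S_m)
    ((-1) ^+ (s : bool) : K) *: \big[wedge/form1]_p X p (s p).

End ExteriorAlgebra.
Arguments form : clear implicits.

Section Calculus.
Context {R : realType} {m : nat}.
Local Notation C := R[i].

Definition cI : C := (0 +i* 1)%C.
Definition toC (x : R) : C := (x +i* 0)%C.
Definition mxC {p q : nat} (X : 'M[R]_(p, q)) : 'M[C]_(p, q) := map_mx toC X.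

Definition pd (a : 'I_m) (f : 'rV[R]_m -> R) (u : 'rV[R]_m) : R :=
  'D_(delta_mx ord0 a) f u.

Definition cpd (a : 'I_m) (f : 'rV[R]_m -> C) (u : 'rV[R]_m) : C :=
  (pd a (fun v => complex.Re (f v)) u +i* pd a (fun v => complex.Im (f v)) u)%C.

Definition mpd {p q : nat} (a : 'I_m) (W : 'rV[R]_m -> 'M[R]_(p, q))
    (u : 'rV[R]_m) : 'M[R]_(p, q) :=
  \matrix_(i, j) pd a (fun v => W v i j) u.

Definition vpd {F : finType} (a : 'I_m) (f : 'rV[R]_m -> {ffun F -> C^o})
    (u : 'rV[R]_m) : {ffun F -> C^o} :=
  [ffun b => cpd a (fun v => f v b) u].

Fixpoint Cn_on (p : nat) (V : set 'rV[R]_m) (f : 'rV[R]_m -> R) : Prop :=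
  (forall u, V u -> {for u, continuous f}) /\
  if p is p'.+1 then
    forall a : 'I_m,
      (forall u, V u -> derivable f u (delta_mx ord0 a)) /\ Cn_on p' V (pd a f)
  else True.

(* smoothness on an open set V *)
Definition smooth_on (V : set 'rV[R]_m) (f : 'rV[R]_m -> R) : Prop :=
  forall p, Cn_on p V f.

Definition csmooth_on (V : set 'rV[R]_m) (f : 'rV[R]_m -> C) : Prop :=
  smooth_on V (fun u => complex.Re (f u)) /\
  smooth_on V (fun u => complex.Im (f u)).

End Calculus.

(* Lebesgue integral over R^m of a nonnegative measurable function, as an
   iterated integral *)
Fixpoint lebesgue_int {R : realType} (m : nat) :
    ('rV[R]_m -> \bar R) -> \bar R :=
  match m with
  | 0 => fun f => f 0
  | m'.+1 => fun f =>
      (\int[@lebesgue_measure R]_t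
         lebesgue_int (fun v : 'rV[R]_m' =>
           f (row_mx (const_mx t : 'rV[R]_1) v)))%E
  end.

(* A smooth atlas of dimension m (not assumed maximal).  inv i is only
   meaningful on the image of the chart i; pref selects for each point a chart
   around it, which is used below to identify fibres with a model space. *)
Record atlas (R : realType) (m : nat) (M : topologicalType) := Atlas {
  idx : Type;
  dom : idx -> set M;
  cht : idx -> M -> 'rV[R]_m;
  inv : idx -> 'rV[R]_m -> M;
  pref : M -> idx;
  pref_dom : forall x, dom (pref x) x;
  dom_open : forall i, open (dom i);
  cod_open : forall i, open (cht i @` dom i);
  chtK : forall i x, dom i x -> inv i (cht i x) = x;
  cht_cont : forall i x, dom i x -> {for x, continuous (cht i)};
  inv_cont : forall i u, (cht i @` dom i) u -> {for u, continuous (inv i)};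
  trans_smooth : forall i j a,
    smooth_on (cht j @` (dom i `&` dom j)) (fun u => cht i (inv j u) ord0 a)
}.

Definition cod {R : realType} {m : nat} {M : topologicalType}
    (A : atlas R m M) (i : idx A) : set 'rV[R]_m := cht i @` dom i.

(* image of dom i `&` dom j in the chart j *)
Definition overlap {R : realType} {m : nat} {M : topologicalType}
    (A : atlas R m M) (i j : idx A) : set 'rV[R]_m :=
  cht j @` (dom i `&` dom j).

(* the Jacobian matrix (d x_i^a / d x_j^b) in the chart j *)
Definition jac {R : realType} {m : nat} {M : topologicalType}
    (A : atlas R m M) (i j : idx A) (u : 'rV[R]_m) : 'M[R]_m :=
  \matrix_(a, b) pd b (fun v => cht i (inv j v) ord0 a) u.

(* M with its Borel sigma-algebra *)
Definition borel (M : ptopologicalType) := g_sigma_algebraType (@open M).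
HB.instance Definition _ (M : ptopologicalType) :=
  Measurable.on (borel M).

(* The top coefficient of (2 pi)^-n w^n / n! for a 2-form w. *)
Definition liouville_coef {R : realType} (n : nat) (W : 'M[R]_n.*2) : R :=
  (2 * pi) ^- n * (n`!%:R)^-1 * top (wpow n (form2 W)).

(* A compact symplectic manifold (M, omega) of dimension 2n with a compatible
   almost complex structure and a prequantum line bundle.
   - Tensors and connections are given by their coordinate expressions in each
     chart, subject to the transformation rules.
   - The Hermitian line bundle l is given by unitary frames over the domains of
     the charts: frame j = (tr i j) * frame i, so a section with coefficient
     f_i in the frame i satisfies f_i = (tr i j) f_j.
   - The connection of l is d - i (conn i) in the frame i; its curvature is
     -i d(conn i), hence dconn.  The class of omega / 2 pi is then integral.
   - liou is the measure of the volume form eps_omega, M being oriented by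
     omega^n. *)
Record prequantum (R : realType) (n : nat) (M : ptopologicalType) := Prequantum {
  atl :> atlas R n.*2 M;
  M_hausdorff : hausdorff_space M;
  M_compact : compact [set: M];

  om : idx atl -> 'rV[R]_n.*2 -> 'M[R]_n.*2;
  om_smooth : forall i a b, smooth_on (cod i) (fun u => om i u a b);
  om_tensor : forall i j u, overlap i j u ->
    om j u = (jac i j u)^T *m om i (cht i (inv j u)) *m jac i j u;
  om_alt : forall i u, cod i u -> (om i u)^T = - om i u;
  om_nondeg : forall i u, cod i u -> om i u \in unitmx;
  om_closed : forall i u a b c, cod i u ->
    pd a (fun v => om i v b c) u + pd b (fun v => om i v c a) u
      + pd c (fun v => om i v a b) u = 0;

  acs : idx atl -> 'rV[R]_n.*2 -> 'M[R]_n.*2;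
  acs_smooth : forall i a b, smooth_on (cod i) (fun u => acs i u a b);
  acs_tensor : forall i j u, overlap i j u ->
    jac i j u *m acs j u = acs i (cht i (inv j u)) *m jac i j u;
  acs_sqr : forall i u, cod i u -> acs i u *m acs i u = - 1%:M;
  acs_sym : forall i u, cod i u ->
    (om i u *m acs i u)^T = om i u *m acs i u;
  acs_pos : forall i u (v : 'cV[R]_n.*2), cod i u -> v != 0 ->
    0 < (v^T *m (om i u *m acs i u) *m v) ord0 ord0;

  tr : idx atl -> idx atl -> M -> R[i];
  tr_smooth : forall i j, csmooth_on (overlap i j) (fun u => tr i j (inv j u));
  tr_unitary : forall i j x, dom i x -> dom j x -> `|tr i j x| = 1;
  tr_cocycle : forall i j l x, dom i x -> dom j x -> dom l x ->
    tr i j x * tr j l x = tr i l x;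
  conn : idx atl -> 'rV[R]_n.*2 -> 'rV[R]_n.*2;
  conn_smooth : forall i a, smooth_on (cod i) (fun u => conn i u ord0 a);
  conn_trans : forall i j u a, overlap i j u ->
    cpd a (fun v => tr i j (inv j v)) u =
    cI * toC ((conn i (cht i (inv j u)) *m jac i j u - conn j u) ord0 a)
      * tr i j (inv j u);
  dconn : forall i u a b, cod i u ->
    pd a (fun v => conn i v ord0 b) u - pd b (fun v => conn i v ord0 a) u =
    om i u a b;

  liou : {finite_measure set (borel M) -> \bar R};
  liouE : forall i (B : set (borel M)), measurable B -> B `<=` dom i ->
    liou B = lebesgue_int (fun u =>
      (\1_(cht i @` B) u * `|liouville_coef (om i u)|)%:E)
}.

Section Geometry.
Context {R : realType} {n : nat} {M : ptopologicalType} (P : prequantum R n M).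
Local Notation C := R[i].
Local Notation pt := 'rV[R]_n.*2.
Implicit Types (i : idx P) (u : pt).

Definition cint (f : M -> C) : C :=
  ((\int[liou P]_(x in [set: borel M]) complex.Re (f x))%R
    +i* (\int[liou P]_(x in [set: borel M]) complex.Im (f x))%R)%C.

Definition met i u : 'M[R]_n.*2 := om i u *m acs i u.
Definition imet i u : 'M[R]_n.*2 := invmx (met i u).

(* Christoffel symbols of the Levi-Civita connection: LC_b d_c is
   \sum_a (LC i u b) a c d_a *)
Definition LC i u (b : 'I_n.*2) : 'M[R]_n.*2 :=
  \matrix_(a, c) (2^-1 * \sum_d imet i u a d *
    (pd b (fun v => met i v d c) u + pd c (fun v => met i v d b) u
       - pd d (fun v => met i v b c) u)).

(* the Levi-Civita covariant derivative of J *)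
Definition DJ i u b : 'M[R]_n.*2 :=
  mpd b (acs i) u + LC i u b *m acs i u - acs i u *m LC i u b.

(* The J-linear part of the Levi-Civita connection,
   (LC - J LC J) / 2 = LC - (J DJ) / 2, is the unitary connection of TM which
   restricts on TM^(1,0) to the projection of the Levi-Civita connection;
   torJ is the difference, which is skew and J-antilinear. *)
Definition torJ i u b : 'M[R]_n.*2 := 2^-1 *: (acs i u *m DJ i u b).
Definition LCJ i u b : 'M[R]_n.*2 := LC i u b - torJ i u b.

Definition P10 i u : 'M[C]_n.*2 := 2^-1 *: (1%:M - cI *: mxC (acs i u)).
Definition P01 i u : 'M[C]_n.*2 := 2^-1 *: (1%:M + cI *: mxC (acs i u)).
Definition T10 i u : set 'cV[C]_n.*2 := [set v | mxC (acs i u) *m v = cI *: v].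
Definition T01 i u : set 'cV[C]_n.*2 :=
  [set v | mxC (acs i u) *m v = - cI *: v].

(* Around each point there are smooth complex coordinates z_1, ..., z_n for
   which J is multiplication by i. *)
Definition J_integrable : Prop :=
  forall i u, cod i u ->
  exists (W : set pt) (z : 'I_n -> pt -> C),
    [/\ open W, W u & W `<=` cod i] /\
    [/\ forall l, csmooth_on W (z l),
        forall v, W v -> \rank (\matrix_(l, a) cpd a (z l) v) = n &
        forall v l b, W v ->
          \sum_a cpd a (z l) v * toC (acs i v a b) = cI * cpd b (z l) v].

(** Characteristic numbers *)

Definition curvJ i u a b : 'M[R]_n.*2 :=
  mpd a (fun v => LCJ i v b) u - mpd b (fun v => LCJ i v a) u
    + LCJ i u a *m LCJ i u b - LCJ i u b *m LCJ i u a.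

(* i F / 2 pi, F the curvature of TM^(1,0), extended by 0 on TM^(0,1) *)
Definition chern_mx i u : 'M[form C n.*2]_n.*2 :=
  \matrix_(p, q) form2 (fun a b =>
    cI * toC (2 * pi)^-1 * (P10 i u *m mxC (curvJ i u a b)) p q).

(* With X := chern_mx, the Todd form is det (X / (1 - e^-X)), that is the
   inverse of det E where E = (1 - e^-X) / X = \sum_l (-X)^l / (l+1)!.
   As 1 - det E is nilpotent this inverse is a finite geometric series. *)
Definition todd_form i u : form C n.*2 :=
  let E := \sum_(l < n.+1)
    map_mx ( *:%R ((-1) ^+ l / (l.+1)`!%:R)) (wmpow l (chern_mx i u)) in
  \sum_(j < n.+1) wpow j (form1 - wdet E).

(* ch (l^k) = exp (k omega / 2 pi) *)
Definition ch_form (k : nat) i u : form C n.*2 :=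
  \sum_(j < n.+1)
    (j`!%:R)^-1 *: wpow j (form2 (fun a b =>
       toC (k%:R * (2 * pi)^-1 * om i u a b))).

(* d = \int_M ch (l^k) Td (TM^(1,0)).  A top degree form is integrated by
   writing it as f eps_omega and integrating the function f. *)
Definition is_riemann_roch_number (k d : nat) : Prop :=
  cint (fun x => let i := pref P x in let u := cht i x in
    top (wedge (ch_form k i u) (todd_form i u)) / toC (liouville_coef (om i u)))
  = d%:R.

(** Hermitian bundles *)

(* The fibre at x is the subspace fib x of the model space C^fr, through the
   frame attached to the chart pref x; so a section is a function M -> C^fr.
   loc s i is the expression of the section s in the frame and the
   coordinates of the chart i. *)
Record hbundle := HBundle {
  fr : finType;
  fib : M -> set {ffun fr -> C^o};
  loc : (M -> {ffun fr -> C^o}) -> forall i : idx P, pt -> {ffun fr -> C^o};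
  hm : M -> {ffun fr -> C^o} -> {ffun fr -> C^o} -> C
}.

Arguments fib : clear implicits.
Arguments hm : clear implicits.
Arguments loc {_} _ _ _.

Definition section (L : hbundle) := M -> {ffun fr L -> C^o}.

Definition smooth_section (L : hbundle) (s : section L) : Prop :=
  (forall x, fib L x (s x)) /\
  forall i b, csmooth_on (cod i) (fun u => loc s i u b).

Definition inner (L : hbundle) (s1 s2 : section L) : C :=
  cint (fun x => hm L x (s1 x) (s2 x)).

Definition orthonormal (L : hbundle) (d : nat) (e : 'I_d -> section L) : Prop :=
  forall j l, inner (e j) (e l) = (j == l)%:R.

Definition lspan (L : hbundle) (d : nat) (e : 'I_d -> section L) :
    set (section L) :=
  [set s | exists c : 'I_d -> C, forall x, s x = \sum_j c j *: e j x].

Definition has_dim (L : hbundle) (H : set (section L)) (d : nat) : Prop :=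
  exists e : 'I_d -> section L, H = lspan e /\
    forall c : 'I_d -> C, (forall x, \sum_j c j *: e j x = 0) ->
      forall j, c j = 0.

Definition orthonormal_basis (L : hbundle) (H : set (section L)) (d : nat)
    (e : 'I_d -> section L) : Prop :=
  orthonormal e /\ H = lspan e.

(* the bundle l^k *)
Definition line_bundle (k : nat) : hbundle := {|
  fr := unit;
  fib := fun _ => setT;
  loc := fun s i u => let x := inv i u in tr i (pref P x) x ^+ k *: s x;
  hm := fun _ v w => conjc (v tt) * w tt
|}.

(* the Hermitian product of forms induced by g: contraction by the g-dual of
   dx^a is the adjoint of dx^a /\ _ *)
Definition hform (G : 'M[C]_n.*2) (eta zeta : form C n.*2) : C :=
  \sum_(S : {set 'I_n.*2})
    conjc (eta S) * foldl (fun z a => int (col a G) z) zeta (enum S) finset.set0.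

(* The bundle of the forms of type (0,q), 0 <= q <= n, twisted by l^k; these are
   the forms annihilated by contraction with TM^(1,0). *)
Definition spinor_bundle (k : nat) : hbundle := {|
  fr := {set 'I_n.*2};
  fib := fun x => let i := pref P x in
    [set eta | forall v, T10 i (cht i x) v -> int v eta = 0];
  loc := fun s i u => let x := inv i u in
    tr i (pref P x) x ^+ k *: pull (mxC (jac (pref P x) i u)) (s x);
  hm := fun x => let i := pref P x in hform (mxC (imet i (cht i x)))
|}.

(** The differential operators *)

(* covariant derivative along d_a twisted by l^k; for l^k itself it is the
   induced connection *)
Definition nabla {F : finType} (k : nat) i (a : 'I_n.*2)
    (f : pt -> {ffun F -> C^o}) u : {ffun F -> C^o} :=
  vpd a f u - (cI * toC (k%:R * conn i u ord0 a)) *: f u.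

(* coordinate expression of the Laplacian nabla^* nabla on l^k *)
Definition lap_loc (k : nat) i (f : pt -> {ffun unit -> C^o}) u :
    {ffun unit -> C^o} :=
  - \sum_a \sum_b toC (imet i u a b) *:
      (nabla k i a (nabla k i b f) u
         - \sum_c toC (LC i u a c b) *: nabla k i c f u).

(* Delta_k = Delta - n k *)
Definition Delta (k : nat) (s : section (line_bundle k)) :
    section (line_bundle k) :=
  fun x => let i := pref P x in
    lap_loc k i (loc s i) (cht i x) - (n * k)%:R *: s x.

Definition eigensection (k : nat) (lam : R) (s : section (line_bundle k)) :=
  smooth_section s /\ forall x, Delta s x = toC lam *: s x.

(* Clifford multiplication by v = v^(1,0) + v^(0,1): sqrt 2 times (exterior
   product by g(v^(1,0), .)) - (contraction by v^(0,1)); then c(v)^2 = -g(v,v) *)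
Definition cliff i u (v : 'cV[C]_n.*2) (eta : form C n.*2) : form C n.*2 :=
  toC (Num.sqrt 2) *:
    (ext ((P10 i u *m v)^T *m mxC (met i u)) eta - int (P01 i u *m v) eta).

(* The Clifford connection on the spinor bundle: the connection induced by
   LCJ, plus the spin lift 1/4 \sum_(p, q) g^(pq) c(d_p) c(A d_q) of the skew
   endomorphism A = torJ, twisted by l^k.  It is compatible with the
   Levi-Civita connection, and induces on det TM^(1,0) the same connection as
   LCJ. *)
Definition nabla_spin (k : nat) i (b : 'I_n.*2) (f : pt -> form C n.*2) u :
    form C n.*2 :=
  nabla k i b f u
  - \sum_a \sum_c toC (LCJ i u b a c) *: ext1 c (int1 a (f u))
  + 4^-1 *: \sum_p \sum_q toC (imet i u p q) *:
      cliff i u (delta_mx p ord0)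
        (cliff i u (mxC (torJ i u b) *m delta_mx q ord0) (f u)).

Definition dirac (k : nat) (s : section (spinor_bundle k)) :
    section (spinor_bundle k) :=
  fun x => let i := pref P x in let u := cht i x in
    \sum_a \sum_b toC (imet i u a b) *:
      cliff i u (delta_mx a ord0) (nabla_spin k i b (loc s i) u).

(** The three quantizations *)

Definition kahler_space (k : nat) : set (section (line_bundle k)) :=
  [set s : section (line_bundle k) | smooth_section s /\
    forall i u v, cod i u -> T01 i u v ->
      \sum_a v a ord0 *: nabla k i a (loc s i) u = 0].

(* e consists of orthonormal eigensections for the first d eigenvalues of
   Delta_k, which lie in ]-a, a[, the others lying to the right of n k + c *)
Definition first_eigensections (k : nat) (a c : R) (d : nat)
    (e : 'I_d -> section (line_bundle k)) : Prop :=
  orthonormal e /\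
  exists lam : 'I_d -> R,
    [/\ forall j, eigensection (lam j) (e j),
        forall j l : 'I_d, (j <= l)%N -> lam j <= lam l,
        forall j, - a < lam j < a &
        forall mu (s : section (line_bundle k)),
          eigensection mu s -> (exists x, s x != 0) ->
          (forall j, inner (e j) s = 0) ->
          (n * k)%:R + c < mu /\ forall j, lam j <= mu].

(* kernels of D_+ (b = false) and D_- (b = true): D restricted to forms of
   even, resp. odd, degree *)
Definition ker_dirac (k : nat) (b : bool) : set (section (spinor_bundle k)) :=
  [set s : section (spinor_bundle k) |
           [/\ smooth_section s,
               forall x (S : {set 'I_n.*2}), odd #|S| != b -> s x S = 0 &
               forall x, dirac s x = 0]].

Arguments kahler_space : clear implicits.
Arguments ker_dirac : clear implicits.

(* quantization k d a c L H: for the tensor power k, H is the quantum Hilbert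
   space of dimension d of one of the three quantizations, in the range of k
   where the vanishing or spectral gap theorem holds *)
Inductive quantization (k d : nat) (a c : R) :
    forall L : hbundle, set (section L) -> Prop :=
| Kahler of J_integrable & has_dim (kahler_space k) d :
    quantization k d a c (kahler_space k)
| AlmostKahler (e : 'I_d -> section (line_bundle k)) of
    first_eigensections a c e : quantization k d a c (lspan e)
| SpinC of (forall s, ker_dirac k true s -> forall x, s x = 0)
    & has_dim (ker_dirac k false) d :
    quantization k d a c (ker_dirac k false).

(** Kernels *)

(* An element of conj(L_x) (x) L_y is given by its coefficients on the
   conj(e_p) (x) e_q, where (e_p) is the standard basis of C^fr. *)
Definition hkernel (L : hbundle) := M -> M -> {ffun fr L * fr L -> C^o}.

(* conj(v) (x) w *)
Definition ctens {F : finType} (v w : {ffun F -> C^o}) :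
    {ffun F * F -> C^o} :=
  [ffun p => conjc (v p.1) * w p.2].

Definition polarized (L : hbundle) (H : set (section L)) (K : hkernel L) : Prop :=
  exists (N : nat) (c : 'I_N -> C) (s1 s2 : 'I_N -> section L),
    [/\ forall l, H (s1 l), forall l, H (s2 l) &
        forall x y, K x y = \sum_l c l *: ctens (s1 l x) (s2 l y)].

Definition delta_fr (F : finType) (q : F) : {ffun F -> C^o} :=
  [ffun p => (p == q)%:R].

(* conj(T) . w for T in conj(L_x) (x) L_y and w in L_y: the antilinear
   extension of conj(conj(u) (x) v) . w = (u (x) conj(v)) . w = h(v, w) u *)
Definition cdot (L : hbundle) (y : M) (T : {ffun fr L * fr L -> C^o})
    (w : {ffun fr L -> C^o}) : {ffun fr L -> C^o} :=
  [ffun p => \sum_q conjc (T (p, q)) * hm L y (delta_fr q) w].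

Definition reproducing (L : hbundle) (H : set (section L)) (K : hkernel L) :
    Prop :=
  forall s, H s -> forall x,
    [ffun p => cint (fun y => cdot y (K x y) (s y) p)] = s x.

Definition basis_kernel (L : hbundle) (d : nat) (theta : 'I_d -> section L) :
    hkernel L :=
  fun x y => \sum_j ctens (theta j x) (theta j y).

End Geometry.

(* Main.v *)
From HB Require Import structures.
Require Import Defs.
From mathcomp Require Import all_boot all_order all_algebra.
From mathcomp Require Import all_classical all_reals all_analysis.
From mathcomp Require Import measurable_realfun complex.
(* The second import restores the names, such as [form], that the libraries
   imported in between redefine. *)
Import Defs.
Set Implicit Arguments.
Unset Strict Implicit.
Unset Printing Implicit Defensive.
Import Order.TTheory GRing.Theory Num.Theory numFieldNormedType.Exports.
Local Open Scope classical_set_scope.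
Local Open Scope ring_scope.

(** Every polarized kernel K can be expanded in its second variable on the basis:
   it is the sum over j of the conj(sigma_j(x)) tensor theta_j(y), for some
   sections sigma_j ([polarized_kernel_of]).  As the theta_j are orthonormal, the
   operator s |-> int conj(K(x,y)).s(y) sends theta_l to sigma_l, hence
   sum_l c_l theta_l to sum_l c_l sigma_l ([kernel_of_reproduces]).  It is the
   identity of H for sigma = theta, which is the reproducing property, and it
   fixes every theta_l only if sigma = theta, which is uniqueness
   ([basis_kernel_reproducing]).  This argument is the same for the three
   quantizations.

   What depends on the quantization is that sums may be taken out of the
   integral: the functions h(s1, s2), for s1 and s2 in H, must be integrable
   ([quantization_hintegrable]).  They are because they are continuous on the
   compact manifold M, which is of finite volume, s1 and s2 being smooth or, in
   the almost Kaehler case, combinations of smooth sections.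

   Continuity is not immediate from the definitions: h is computed in the frame
   of the chart selected at each point, and this selection need not be
   continuous.  Around a given point h(s1, s2) has to be rewritten in one fixed
   chart.  For the line bundle this uses that the transition functions are
   unitary.  For spinors one needs in addition that the Hermitian product of
   forms is invariant under a change of coordinates ([hform_pull]); this rests
   on two facts of exterior algebra, that contraction is adjoint to the exterior
   product ([hform_ext]) and that contraction is an antiderivation
   ([int_ext]). *)

(** * Exterior algebra *)

Section Signs.
Context {K : comNzRingType} {m : nat}.
Implicit Types (a b : 'I_m) (S : {set 'I_m}) (eta : form K m).

Lemma esignK S a : esign S a * esign S a = 1 :> K.
Proof. by rewrite /esign -signr_odd -signr_addb addbb. Qed.

Lemma esignD1 S a b : a \in S ->
  esign S b = (-1) ^+ (a < b)%N * esign (S :\ a)%SET b :> K.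
Proof.
move=> aS; rewrite /esign (cardsD1 a) !inE aS /= exprD; congr (_ * _ ^+ _).
by apply: eq_card => c; rewrite !inE andbA.
Qed.

Lemma esignU1 S a b : a \notin S ->
  esign (a |: S)%SET b = (-1) ^+ (a < b)%N * esign S b :> K.
Proof. by move=> aS; rewrite (esignD1 _ (finset.setU11 a S)) finset.setU1K. Qed.

Lemma sign_ltC a b : a != b ->
  (-1) ^+ (a < b)%N = - (-1) ^+ (b < a)%N :> K.
Proof.
rewrite -val_eqE neq_ltn => /orP[] h; rewrite h ltnNge (ltnW h) /=.
  by rewrite expr1 expr0.
by rewrite expr1 expr0 opprK.
Qed.

Lemma ext1_is_linear a : linear (@ext1 K m a).
Proof.
move=> c u v; apply/ffunP=> S; rewrite !ffunE.
case: ifP => _; rewrite ?scaler0 ?addr0//.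
by rewrite mulrDr /GRing.scale/= mulrCA.
Qed.
HB.instance Definition _ a := GRing.isLinear.Build K (form K m) (form K m) _
  (@ext1 K m a) (ext1_is_linear a).

Lemma int1_is_linear a : linear (@int1 K m a).
Proof.
move=> c u v; apply/ffunP=> S; rewrite !ffunE.
case: ifP => _; rewrite ?scaler0 ?addr0//.
by rewrite mulrDr /GRing.scale/= mulrCA.
Qed.
HB.instance Definition _ a := GRing.isLinear.Build K (form K m) (form K m) _
  (@int1 K m a) (int1_is_linear a).

Lemma ext_is_linear (c : 'rV[K]_m) : linear (ext c).
Proof.
move=> x u v; rewrite /ext scaler_sumr -big_split; apply: eq_bigr => a _ /=.
by rewrite linearP scalerDr !scalerA mulrC.
Qed.
HB.instance Definition _ c := GRing.isLinear.Build K (form K m) (form K m) _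
  (@ext K m c) (ext_is_linear c).

Lemma int_is_linear (v : 'cV[K]_m) : linear (int v).
Proof.
move=> x u w; rewrite /int scaler_sumr -big_split; apply: eq_bigr => a _ /=.
by rewrite linearP scalerDr !scalerA mulrC.
Qed.
HB.instance Definition _ v := GRing.isLinear.Build K (form K m) (form K m) _
  (@int K m v) (int_is_linear v).

Lemma pull_is_linear (D : 'M[K]_m) : linear (pull D).
Proof.
move=> x u w; rewrite /pull scaler_sumr -big_split; apply: eq_bigr => S _ /=.
by rewrite !ffunE scalerDl scalerA.
Qed.
HB.instance Definition _ D := GRing.isLinear.Build K (form K m) (form K m) _
  (@pull K m D) (pull_is_linear D).

Lemma ext1C a b eta : a != b -> ext1 a (ext1 b eta) = - ext1 b (ext1 a eta).
Proof.
move=> ab; apply/ffunP=> S; rewrite !ffunE !inE (eq_sym b a) ab /=.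
case: ifP => aS; case: ifP => bS; rewrite ?(mulr0, oppr0)//.
rewrite (esignD1 b aS) (esignD1 a bS) (sign_ltC ab) !mulrA.
rewrite !finset.setDDl [(_ |: _)%SET]finset.setUC !(mulNr, mulrN, opprK).
by congr (_ * _); rewrite mulrAC.
Qed.

Lemma int1C a b eta : a != b -> int1 a (int1 b eta) = - int1 b (int1 a eta).
Proof.
move=> ab; apply/ffunP=> S; rewrite !ffunE !inE (eq_sym b a) (negPf ab) /=.
case: ifP => aS; case: ifP => bS; rewrite ?(mulr0, oppr0)//.
rewrite (esignU1 b (negbT aS)) (esignU1 a (negbT bS)) (sign_ltC ab) !mulrA.
rewrite (finset.setUCA [set b]%SET).
rewrite !(mulNr, mulrN, opprK).
by congr (- (_ * _)); rewrite mulrC mulrA mulrAC.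
Qed.

Lemma int1_ext1_same a eta : int1 a (ext1 a eta) = eta - ext1 a (int1 a eta).
Proof.
apply/ffunP=> S; rewrite !ffunE !inE eqxx /=; case: ifP => aS.
  rewrite finset.setD1K // mulrA (esignD1 a aS) ltnn mul1r esignK.
  by rewrite mul1r subrr.
rewrite subr0 finset.setU1K ?aS // mulrA (esignU1 a (negbT aS)) ltnn.
by rewrite mul1r esignK mul1r.
Qed.

Lemma int1_ext1_diff a b eta : a != b ->
  int1 a (ext1 b eta) = - ext1 b (int1 a eta).
Proof.
move=> ab; apply/ffunP=> S; rewrite !ffunE !inE (eq_sym b a) (negPf ab) /=.
case: ifP => aS; case: ifP => bS; rewrite ?(mulr0, oppr0)//.
have -> : ((a |: S) :\ b = a |: (S :\ b))%SET.
  rewrite finset.setDUl; congr (_ :|: _)%SET; apply/finset.setDidPl.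
  by rewrite finset.disjoints1 inE.
rewrite (esignU1 b (negbT aS)) (esignD1 a bS) (sign_ltC ab) !mulrA.
rewrite !(mulNr, mulrN, opprK); congr (- (_ * _)).
rewrite [(-1) ^+ _ * _]mulrC -[X in X * esign S b]mulrA -expr2.
by rewrite sqrr_sign mulr1 mulrC.
Qed.

(** The anticommutation relation of exterior and interior products: contraction
   is an antiderivation. *)
Lemma int_ext1 (v : 'cV[K]_m) b eta :
  int v (ext1 b eta) = v b ord0 *: eta - ext1 b (int v eta).
Proof.
rewrite /int linear_sum (bigD1 b)//= [in RHS](bigD1 b)//=.
rewrite int1_ext1_same scalerBr.
rewrite [ext1 b (_ *: _)]linearZ /= opprD addrA -sumrN; congr (_ + _).
apply: eq_bigr => a ab.
by rewrite int1_ext1_diff // scalerN [ext1 b (_ *: _)]linearZ.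
Qed.

Lemma int_ext (v : 'cV[K]_m) (c : 'rV[K]_m) eta :
  int v (ext c eta) = (c *m v) ord0 ord0 *: eta - ext c (int v eta).
Proof.
rewrite /ext linear_sum mxE scaler_suml -sumrB; apply: eq_bigr => a _.
by rewrite linearZ /= int_ext1 scalerBr scalerA.
Qed.

End Signs.

Section Alternating.
Context {K : numFieldType} {m : nat}.
Implicit Types (a b : 'I_m) (S : {set 'I_m}) (eta : form K m).

Lemma eqN_eq0 (V : lmodType K) (x : V) : x = - x -> x = 0.
Proof.
move=> h; have /eqP : 2%:R *: x = 0 by rewrite scaler_nat mulr2n {1}h addNr.
by rewrite scaler_eq0 pnatr_eq0 => /eqP.
Qed.

Lemma ext1_ext1 a b eta : ext1 a (ext1 b eta) = - ext1 b (ext1 a eta).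
Proof.
have [->|] := eqVneq a b; last exact: ext1C.
apply/ffunP=> S; rewrite !ffunE; case: ifP => bS; rewrite ?oppr0//.
by rewrite !inE eqxx /= mulr0 oppr0.
Qed.

Lemma int1_int1 a b eta : int1 a (int1 b eta) = - int1 b (int1 a eta).
Proof.
have [->|] := eqVneq a b; last exact: int1C.
apply/ffunP=> S; rewrite !ffunE; case: ifP => bS; rewrite ?oppr0//.
by rewrite !inE eqxx /= mulr0 oppr0.
Qed.

Lemma ext_ext (c d : 'rV[K]_m) eta : ext c (ext d eta) = - ext d (ext c eta).
Proof.
rewrite /ext -sumrN; under eq_bigr do rewrite linear_sum scaler_sumr.
rewrite exchange_big /=; apply: eq_bigr => b _.
rewrite [X in - (_ *: X)]linear_sum scaler_sumr -sumrN.
apply: eq_bigr => a _ /=.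
rewrite [ext1 a _]linearZ [ext1 b (_ *: _)]linearZ /= ext1_ext1.
by rewrite !scalerN !scalerA mulrC.
Qed.

Lemma int_int (v w : 'cV[K]_m) eta : int v (int w eta) = - int w (int v eta).
Proof.
rewrite /int -sumrN; under eq_bigr do rewrite linear_sum scaler_sumr.
rewrite exchange_big /=; apply: eq_bigr => b _.
rewrite [X in - (_ *: X)]linear_sum scaler_sumr -sumrN.
apply: eq_bigr => a _ /=.
rewrite [int1 a _]linearZ [int1 b (_ *: _)]linearZ /= int1_int1.
by rewrite !scalerN !scalerA mulrC.
Qed.

Lemma enum_ord_split a : exists l r : seq 'I_m,
  [/\ fintype.enum 'I_m = l ++ a :: r, {in l, forall b, (b < a)%N}
    & {in r, forall b, (a < b)%N}].
Proof.
exists (take a (fintype.enum 'I_m)), (drop a.+1 (fintype.enum 'I_m)).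
have sz : size (fintype.enum 'I_m) = m by rewrite size_enum_ord.
split.
- rewrite -{1}(cat_take_drop a (fintype.enum 'I_m)) (drop_nth a) ?sz //.
  by rewrite fintype.nth_ord_enum.
- move=> b /(map_f val); rewrite map_take val_enum_ord take_iota.
  by rewrite mem_iota /= add0n leq_min => /andP[].
- move=> b /(map_f val); rewrite map_drop val_enum_ord drop_iota.
  by rewrite mem_iota /= add0n => /andP[].
Qed.

Lemma enum_set_ord S : fintype.enum S = seq.filter (mem S) (fintype.enum 'I_m).
Proof. by rewrite [in RHS]enumT. Qed.

(** [esign S a] is the sign of the permutation that sorts [a] into the
   increasing enumeration of [S]: it passes the elements of [S] that are
   smaller. *)
Lemma enum_setU1_ord a S : a \notin S -> exists l r : seq 'I_m,
  [/\ fintype.enum S = l ++ r, fintype.enum (a |: S)%SET = l ++ a :: r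
    & size l = #|[set b in S | (b < a)%N]%SET|].
Proof.
move=> aS; have [l [r [E ll rr]]] := enum_ord_split a.
exists (seq.filter (mem S) l), (seq.filter (mem S) r); split.
- by rewrite enum_set_ord E filter_cat /= (negPf aS).
- rewrite enum_set_ord E filter_cat /= !inE eqxx /=; congr (_ ++ _ :: _).
    apply: eq_in_filter => b /ll; rewrite /= !inE.
    by case: eqVneq => // ->; rewrite ltnn.
  apply: eq_in_filter => b /rr; rewrite /= !inE.
  by case: eqVneq => // ->; rewrite ltnn.
rewrite cardE enum_set_ord E filter_cat /= !inE ltnn andbF.
rewrite [X in _ ++ X](_ : _ = [::]) ?cats0; last first.
  rewrite -(filter_pred0 r); apply: eq_in_filter => b /rr ab.
  by rewrite /= !inE ltnNge (ltnW ab) andbF.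
congr size; apply: eq_in_filter => b /ll ab.
by rewrite /= !inE ab andbT.
Qed.

Section Words.
Context {V : lmodType K} (Phi : seq 'I_m -> V).
Hypothesis PhiC : forall l a b r,
  Phi (l ++ a :: b :: r) = - Phi (l ++ b :: a :: r).

Lemma alt_move a s r :
  Phi (a :: s ++ r) = (-1) ^+ size s *: Phi (s ++ a :: r).
Proof.
suff H l : Phi (l ++ a :: s ++ r) = (-1) ^+ size s *: Phi (l ++ s ++ a :: r).
  exact: (H [::]).
elim: s l => [|b s IH] l /=; first by rewrite expr0 scale1r.
by rewrite PhiC -cat_rcons IH cat_rcons exprS mulN1r scaleNr.
Qed.

Lemma alt_dup a s r : Phi (a :: s ++ a :: r) = 0.
Proof.
rewrite -[s ++ _]/(s ++ [:: a] ++ r) alt_move.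
apply/eqP; rewrite scaler_eq0 signr_eq0 /=; apply/eqP/eqN_eq0.
by rewrite {1}PhiC.
Qed.

Lemma alt_enumU1 a S : a \notin S ->
  Phi (fintype.enum (a |: S)%SET) = esign S a *: Phi (a :: fintype.enum S).
Proof.
move=> aS; have [l [r [-> -> sz]]] := enum_setU1_ord aS.
by rewrite alt_move /esign -sz scalerA -signr_odd -signr_addb addbb scale1r.
Qed.

(** A form is a combination of increasing words, and an alternating function of
   words sees [ext1 a] as putting the letter [a] in front: the sign in [ext1]
   is the one that sorts the word, and words with a repeated letter count for
   0. It is applied below to substitution and to the Hermitian product, which
   are both defined by iterating anticommuting operators along a word. *)
Lemma alt_ext1 a eta :
  \sum_(S : {set 'I_m}) ext1 a eta S *: Phi (fintype.enum S) =
  \sum_(S : {set 'I_m}) eta S *: Phi (a :: fintype.enum S).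
Proof.
rewrite [RHS](bigID (fun S : {set 'I_m} => a \in S)) /=.
rewrite [X in _ = X + _]big1 ?add0r; last first.
  move=> S aS.
  have [l [r [_ E _]]] := enum_setU1_ord (negbT (finset.setD11 a S)).
  by rewrite finset.setD1K // in E; rewrite E alt_dup scaler0.
rewrite (bigID (fun S : {set 'I_m} => a \in S)) /=.
rewrite [X in _ + X]big1 ?addr0; last first.
  by move=> S /negPf aS; rewrite ffunE aS scale0r.
rewrite (reindex_onto (fun S => a |: S)%SET (fun S => S :\ a)%SET) /=; last first.
  by move=> S aS; rewrite finset.setD1K.
apply: eq_big => [S|S /andP[_ /eqP aS]].
  rewrite finset.setU11 /=; apply/eqP/idP => [<-|].
    by rewrite finset.setD11.
  exact: finset.setU1K.
have aS' : a \notin S by rewrite -aS finset.setD11.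
rewrite ffunE finset.setU11 finset.setU1K // alt_enumU1 // scalerA.
rewrite (esignU1 a aS') ltnn mul1r.
by rewrite mulrAC esignK mul1r.
Qed.

End Words.

(** The algebra is generated by the dx^a, so that a property stable under
   linear combinations need only be propagated along exterior products. *)
Lemma form_ind (Q : form K m -> Prop) :
  (forall c eta zeta, Q eta -> Q zeta -> Q (c *: eta + zeta)) ->
  Q (form1 : form K m) -> (forall a eta, Q eta -> Q (ext1 a eta)) ->
  forall eta, Q eta.
Proof.
move=> QP Q1 Qe.
have Q0 : Q 0 by rewrite -(addNr form1) -scaleN1r; exact: QP.
(* the basis form dx^S *)
pose del (S : {set 'I_m}) : form K m := [ffun T => (T == S)%:R].
have Qd S : Q (del S).
  have [k] := ubnP #|S|; elim: k S => // k IH S; rewrite ltnS => Sk.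
  have [->//|[a aS]] := finset.set_0Vmem S.
  have -> : del S = esign (S :\ a)%SET a *: ext1 a (del (S :\ a)%SET) + 0.
    apply/ffunP=> T; rewrite !ffunE addr0 /GRing.scale/=.
    have [->|TS] := eqVneq T S.
      by rewrite aS eqxx mulr1 (esignD1 a aS) ltnn mul1r esignK.
    case: ifP => [aT|]; last by rewrite mulr0.
    case: eqP => [E|]; last by rewrite !mulr0.
    by case/eqP: TS; rewrite -(finset.setD1K aT) -(finset.setD1K aS) E.
  apply: QP => //; apply: Qe; apply: IH.
  by rewrite (cardsD1 a) aS in Sk.
move=> eta; have -> : eta = \sum_(S : {set 'I_m}) eta S *: del S.
  apply/ffunP=> T; rewrite sum_ffunE (bigD1 T) //= big1 ?addr0 => [|S ST].
    by rewrite !ffunE eqxx /GRing.scale/= mulr1.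
  by rewrite !ffunE eq_sym (negPf ST) scaler0.
by elim/big_rec: _ => // S zeta _ Qz; exact: QP.
Qed.

Lemma foldr_ext_alt (D : 'M[K]_m) l a b r :
  let Psi := foldr (fun a => ext (row a D)) (form1 : form K m) in
  Psi (l ++ a :: b :: r) = - Psi (l ++ b :: a :: r).
Proof.
move=> Psi; rewrite /Psi.
by elim: l => [|d l /= ->]; rewrite ?linearN //= ext_ext.
Qed.

Lemma pull_ext1 (D : 'M[K]_m) a eta :
  pull D (ext1 a eta) = ext (row a D) (pull D eta).
Proof.
rewrite /pull (alt_ext1 (@foldr_ext_alt D)) linear_sum.
by apply: eq_bigr => S _; rewrite linearZ.
Qed.

Lemma pull_form1 (D : 'M[K]_m) : pull D form1 = form1 :> form K m.
Proof.
rewrite /pull (bigD1 finset.set0) //= big1 ?addr0 => [|S /negPf S0]; last first.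
  by rewrite ffunE S0 scale0r.
by rewrite ffunE eqxx scale1r enum_set0.
Qed.

Lemma int_form1 (v : 'cV[K]_m) : int v form1 = 0 :> form K m.
Proof.
rewrite /int big1 // => a _; apply/ffunP=> S; rewrite !ffunE.
case: ifP => _; rewrite ?scaler0 //.
have /negPf-> : (a |: S != finset.set0)%SET.
  by apply/finset.set0Pn; exists a; rewrite finset.setU11.
by rewrite mulr0 scaler0.
Qed.

(** Naturality of the contraction: both sides are antiderivations along the
   substitution, and they agree on the covectors dx^a. *)
Lemma int_pull (D : 'M[K]_m) (v : 'cV[K]_m) eta :
  int v (pull D eta) = pull D (int (D *m v) eta).
Proof.
elim/form_ind: eta => [c eta zeta h1 h2||a eta IH].
- by rewrite !linearP /= h1 h2.
- by rewrite pull_form1 !int_form1 linear0.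
rewrite pull_ext1 int_ext int_ext1 linearB linearZ /= pull_ext1 IH.
congr (_ *: _ - _); rewrite !mxE; apply: eq_bigr => b _.
by rewrite !mxE.
Qed.

End Alternating.

(** * The Hermitian product of forms *)

Section Hform.
Context {R : realType} {n : nat}.
Local Notation C := R[i].
Local Notation m := n.*2.
Implicit Types (G : 'M[C]_m) (eta zeta : form C m).

Definition contr G (s : seq 'I_m) zeta : C^o :=
  foldl (fun z a => int (col a G) z) zeta s finset.set0.

Lemma contr_is_linear G s : linear (contr G s).
Proof.
rewrite /contr; elim: s => [|a s IH] c z w /=; first by rewrite 2!ffunE.
by rewrite linearP IH.
Qed.
HB.instance Definition _ G s := GRing.isLinear.Build C (form C m) C^o _
  (contr G s) (contr_is_linear G s).

Lemma contr_alt G zeta l a b r :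
  contr G (l ++ a :: b :: r) zeta = - contr G (l ++ b :: a :: r) zeta.
Proof.
rewrite /contr !foldl_cat /= int_int.
exact: (linearN (contr G r)).
Qed.

Definition conj_form eta : form C m := [ffun S => conjc (eta S)].

Lemma hformE G eta zeta : hform G eta zeta =
  \sum_(S : {set 'I_m}) conj_form eta S *: contr G (fintype.enum S) zeta.
Proof. by apply: eq_bigr => S _; rewrite ffunE. Qed.

Lemma conj_ext1 a eta : conj_form (ext1 a eta) = ext1 a (conj_form eta).
Proof.
apply/ffunP=> S; rewrite !ffunE; case: ifP => _; rewrite ?rmorph0 //.
by rewrite rmorphM rmorph_sign.
Qed.

Lemma hform_is_linear G eta : linear (hform G eta : form C m -> C^o).
Proof.
move=> c z w; rewrite !hformE scaler_sumr -big_split; apply: eq_bigr => S _ /=.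
by rewrite linearP scalerDr !scalerA mulrC.
Qed.

HB.instance Definition _ G eta := GRing.isLinear.Build C (form C m) C^o _
  (hform G eta : form C m -> C^o) (hform_is_linear G eta).

Lemma hform_linearl G c eta1 eta2 zeta :
  hform G (c *: eta1 + eta2) zeta =
  conjc c * hform G eta1 zeta + hform G eta2 zeta.
Proof.
rewrite !hformE mulr_sumr -big_split; apply: eq_bigr => S _ /=.
by rewrite !ffunE rmorphD rmorphM /GRing.scale /= mulrDl mulrA.
Qed.

Lemma hform_unit G t eta zeta : conjc t * t = 1 ->
  hform G (t *: eta) (t *: zeta) = hform G eta zeta.
Proof.
move=> t1.
have -> : hform G (t *: eta) (t *: zeta) = t * hform G (t *: eta) zeta.
  by rewrite linearZ.
rewrite !hformE mulr_sumr; apply: eq_bigr => S _ /=.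
by rewrite !ffunE rmorphM /GRing.scale /= !mulrA [t * _]mulrC t1 mul1r.
Qed.

Lemma hform_suml G (I : finType) (c : I -> C) (eta : I -> form C m) zeta :
  hform G (\sum_i c i *: eta i) zeta =
  \sum_i conjc (c i) * hform G (eta i) zeta.
Proof.
elim/big_rec2: _ => [|i x y _ <-]; last exact: hform_linearl.
have := hform_linearl G (-1) 0 0 zeta.
by rewrite scaler0 add0r rmorphN1 mulN1r addNr.
Qed.

Lemma hform_ext1 G a eta zeta :
  hform G (ext1 a eta) zeta = hform G eta (int (col a G) zeta).
Proof.
rewrite !hformE conj_ext1.
exact: (alt_ext1 (Phi := fun s => contr G s zeta) (contr_alt G zeta)).
Qed.

(** For the product of forms induced by [G], the adjoint of the exterior
   product by a covector is the contraction by the dual vector. *)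
Lemma hform_ext G (c : 'rV[C]_m) eta zeta :
  hform G (ext c eta) zeta = hform G eta (int (G *m (map_mx conjc c)^T) zeta).
Proof.
rewrite /ext hform_suml; under eq_bigr do rewrite hform_ext1.
rewrite /int [RHS]linear_sum /=; under eq_bigr do rewrite linear_sum mulr_sumr.
rewrite exchange_big; apply: eq_bigr => b _ /=.
rewrite !linearZ /= /GRing.scale /= !mxE mulr_suml.
apply: eq_bigr => a _.
by rewrite linearZ !mxE /GRing.scale /= mulrA [_^*%C * _]mulrC.
Qed.

Lemma hform_form1 G zeta : hform G form1 zeta = zeta finset.set0.
Proof.
rewrite /hform (bigD1 finset.set0) //= big1 ?addr0 => [|S /negPf S0]; last first.
  by rewrite ffunE S0 rmorph0 mul0r.
by rewrite ffunE eqxx rmorph1 mul1r enum_set0.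
Qed.

Lemma pull_set0 (D : 'M[C]_m) zeta : pull D zeta finset.set0 = zeta finset.set0.
Proof.
elim/(@form_ind R[i] m): zeta => [c z w h1 h2||a z _].
- by rewrite linearP !ffunE h1 h2.
- by rewrite pull_form1.
rewrite pull_ext1 /ext sum_ffunE big1 => [|b _]; rewrite !ffunE finset.inE //.
by rewrite scaler0.
Qed.

(** The Hermitian product of forms is invariant under a change of coordinates:
   an exterior factor of the first argument is moved by adjunction to a
   contraction of the second, which commutes with substitution. *)
Lemma hform_pull G (D : 'M[C]_m) eta zeta : map_mx conjc D = D ->
  hform G (pull D eta) (pull D zeta) = hform (D *m G *m D^T) eta zeta.
Proof.
move=> Dr.
elim/(@form_ind R[i] m): eta zeta => [c eta1 eta2 h1 h2|zeta|a eta IH zeta].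
- by move=> zeta; rewrite linearP !hform_linearl h1 h2.
- by rewrite pull_form1 !hform_form1 pull_set0.
rewrite pull_ext1 hform_ext int_pull IH hform_ext1; congr (hform _ _ (int _ _)).
rewrite map_row Dr mulmxA; apply/matrixP=> i j.
by rewrite !mxE; apply: eq_bigr => k _; rewrite !mxE.
Qed.

End Hform.

(** * Continuity of complex-valued functions *)

Section ComplexContinuity.
Context {R : realType} {T : topologicalType}.
Local Notation C := R[i].
Implicit Types (f g : T -> C) (u : T).

(** Continuity is tested on the real and imaginary parts because this is how
   smoothness and the integral are defined for complex-valued functions. *)
Definition ccont u f :=
  continuous_at u (fun v => complex.Re (f v)) /\
  continuous_at u (fun v => complex.Im (f v)).

Lemma cReD (x y : C) : complex.Re (x + y) = complex.Re x + complex.Re y.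
Proof. by case: x; case: y. Qed.
Lemma cImD (x y : C) : complex.Im (x + y) = complex.Im x + complex.Im y.
Proof. by case: x; case: y. Qed.
Lemma cReM (x y : C) : complex.Re (x * y) =
  complex.Re x * complex.Re y - complex.Im x * complex.Im y.
Proof. by case: x; case: y. Qed.
Lemma cImM (x y : C) : complex.Im (x * y) =
  complex.Re x * complex.Im y + complex.Im x * complex.Re y.
Proof. by case: x; case: y. Qed.

Let rcontM (u : T) (f g : T -> R) : continuous_at u f -> continuous_at u g ->
  continuous_at u (fun v => f v * g v).
Proof. by move=> fu gu; apply: cvgM. Qed.

Let rcontD (u : T) (f g : T -> R) : continuous_at u f -> continuous_at u g ->
  continuous_at u (fun v => f v + g v).
Proof. by move=> fu gu; apply: cvgD. Qed.

Let rcontB (u : T) (f g : T -> R) : continuous_at u f -> continuous_at u g ->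
  continuous_at u (fun v => f v - g v).
Proof. by move=> fu gu; apply: cvgB. Qed.

Lemma cReJ (x : C) : complex.Re (conjc x) = complex.Re x.
Proof. by case: x. Qed.
Lemma cImJ (x : C) : complex.Im (conjc x) = - complex.Im x.
Proof. by case: x. Qed.
Lemma cReV (x : C) :
  complex.Re x^-1 = complex.Re x / (complex.Re x ^+ 2 + complex.Im x ^+ 2).
Proof. by case: x. Qed.
Lemma cImV (x : C) :
  complex.Im x^-1 = - (complex.Im x / (complex.Re x ^+ 2 + complex.Im x ^+ 2)).
Proof. by case: x. Qed.

Lemma ccont_cst u (c : C) : ccont u (fun=> c).
Proof. by split; exact: cst_continuous. Qed.

Lemma ccontD u f g : ccont u f -> ccont u g -> ccont u (fun v => f v + g v).
Proof.
move=> [f1 f2] [g1 g2]; split.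
  by under eq_fun do rewrite cReD; apply: cvgD.
by under eq_fun do rewrite cImD; apply: cvgD.
Qed.

Lemma ccontM u f g : ccont u f -> ccont u g -> ccont u (fun v => f v * g v).
Proof.
move=> [f1 f2] [g1 g2]; split.
  by under eq_fun do rewrite cReM; apply: rcontB; exact: rcontM.
by under eq_fun do rewrite cImM; apply: rcontD; exact: rcontM.
Qed.

Lemma ccontJ u f : ccont u f -> ccont u (fun v => conjc (f v)).
Proof.
move=> [f1 f2]; split.
  by under eq_fun do rewrite cReJ.
under eq_fun do rewrite cImJ.
exact: cvgN.
Qed.

Lemma ccontV u f : f u != 0 -> ccont u f -> ccont u (fun v => (f v)^-1).
Proof.
move=> fu [f1 f2].
pose N v := complex.Re (f v) ^+ 2 + complex.Im (f v) ^+ 2.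
have Nc : continuous_at u N by apply: rcontD; exact: rcontM.
have Nu : N u != 0.
  rewrite paddr_eq0 ?sqr_ge0 // !sqrf_eq0; move: fu; apply: contraNN.
  by case: (f u) => a b /= /andP[/eqP-> /eqP->].
have Vc : continuous_at u (fun v => (N v)^-1) by exact: cvgV.
split; first by under eq_fun do rewrite cReV; exact: (rcontM f1 Vc).
by under eq_fun do rewrite cImV; apply: cvgN; exact: (rcontM f2 Vc).
Qed.

Lemma ccont_sum u (I : Type) (r : seq I) (p : pred I) (F : I -> T -> C) :
  (forall i, p i -> ccont u (F i)) ->
  ccont u (fun v => \sum_(i <- r | p i) F i v).
Proof.
move=> h; elim: r => [|i r IH].
  by under eq_fun do rewrite big_nil; exact: ccont_cst.
under eq_fun do rewrite big_cons.
by have [pi|//] := boolP (p i); exact: ccontD (h i pi) IH.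
Qed.

Lemma ccont_prod u (I : Type) (r : seq I) (p : pred I) (F : I -> T -> C) :
  (forall i, p i -> ccont u (F i)) ->
  ccont u (fun v => \prod_(i <- r | p i) F i v).
Proof.
move=> h; elim: r => [|i r IH].
  by under eq_fun do rewrite big_nil; exact: ccont_cst.
under eq_fun do rewrite big_cons.
by have [pi|//] := boolP (p i); exact: ccontM (h i pi) IH.
Qed.

Lemma ccont_near u f g :
  (\forall v \near u, f v = g v) -> ccont u g -> ccont u f.
Proof.
move=> fg [g1 g2]; have fu := nbhs_singleton fg.
split; rewrite /prop_for /continuous_at fu.
  by apply: cvg_trans g1; apply: near_eq_cvg; near=> v; rewrite (near fg v).
by apply: cvg_trans g2; apply: near_eq_cvg; near=> v; rewrite (near fg v).
Unshelve. all: by end_near. Qed.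

Lemma ccont_det u (m : nat) (A : T -> 'M[C]_m) :
  (forall i j, ccont u (fun v => A v i j)) -> ccont u (fun v => \det (A v)).
Proof.
move=> h; apply: ccont_sum => s _; apply: ccontM; first exact: ccont_cst.
exact: ccont_prod.
Qed.

Lemma ccont_invmx u (m : nat) (A : T -> 'M[C]_m) :
  (\forall v \near u, A v \in unitmx) ->
  (forall i j, ccont u (fun v => A v i j)) ->
  forall i j, ccont u (fun v => invmx (A v) i j).
Proof.
move=> Au h i j.
apply: (@ccont_near _ _ (fun v => (\det (A v))^-1 * cofactor (A v) j i)).
  by near=> v; rewrite /invmx (near Au v) // !mxE.
apply: ccontM.
  apply: ccontV; last exact: ccont_det.
  by rewrite -unitfE; exact: nbhs_singleton Au.
apply: ccontM; first exact: ccont_cst.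
by apply: ccont_det => a b; under eq_fun do rewrite !mxE; exact: h.
Unshelve. all: by end_near. Qed.

Lemma ccont_mulmx u (p q r : nat)
    (A : T -> 'M[C]_(p, q)) (B : T -> 'M[C]_(q, r)) :
  (forall i j, ccont u (fun v => A v i j)) ->
  (forall i j, ccont u (fun v => B v i j)) ->
  forall i j, ccont u (fun v => (A v *m B v) i j).
Proof.
move=> hA hB i j; under eq_fun do rewrite mxE.
by apply: ccont_sum => k _; exact: ccontM.
Qed.

Lemma ccont_hform u (n : nat)
    (G : T -> 'M[C]_n.*2) (eta zeta : T -> form C n.*2) :
  (forall i j, ccont u (fun v => G v i j)) ->
  (forall S, ccont u (fun v => eta v S)) ->
  (forall S, ccont u (fun v => zeta v S)) ->
  ccont u (fun v => hform (G v) (eta v) (zeta v)).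
Proof.
move=> hG he hz; apply: ccont_sum => S _; apply: ccontM; first exact: ccontJ.
elim: (fintype.enum S) zeta hz => [|a s IH] zeta hz /=; first exact: hz.
apply: (IH (fun v => int (col a (G v)) (zeta v))) => S'.
under eq_fun do rewrite sum_ffunE.
apply: ccont_sum => b _; under eq_fun do rewrite !ffunE mxE.
apply: ccontM; first exact: hG.
have [_|_] := boolP (b \in S'); first exact: ccont_cst.
exact: ccontM (ccont_cst _ _) (hz _).
Qed.

End ComplexContinuity.

Lemma ccont_comp (R : realType) (T U : topologicalType)
    (g : T -> U) (f : U -> R[i]) x :
  {for x, continuous g} -> ccont (g x) f -> ccont x (f \o g).
Proof.
move=> gx [f1 f2]; split.
  exact: (@continuous_comp _ _ _ g (fun v => complex.Re (f v))).
exact: (@continuous_comp _ _ _ g (fun v => complex.Im (f v))).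
Qed.

(** * Integration over M *)

Section Integration.
Context {R : realType} {n : nat} {M : ptopologicalType} (P : prequantum R n M).
Local Notation C := R[i].
Local Notation rint f :=
  ((liou P).-integrable [set: borel M] (EFin \o (f : borel M -> R))).

Definition cintegrable (f : M -> C) : Prop :=
  rint (fun x => complex.Re (f x)) /\ rint (fun x => complex.Im (f x)).

(** A continuous function is bounded, because M is compact, and Borel
   measurable, and the Liouville measure is finite. *)
Lemma continuous_integrable (f : M -> R) : continuous f -> rint f.
Proof.
move=> cf; apply: measurable_bounded_integrable => //.
- by rewrite ltey_eq fin_num_measure.
- apply: (measurability _ (RGenOpens.measurableE R)).
  move=> _ [_ [a [b ->] <-]]; rewrite setTI; apply: sub_sigma_algebra.
  by move/continuousP: cf; apply; exact: interval_open.
have [|N [_ mrt]] := @compact_bounded _ _ (f @` [set: M]).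
  apply: continuous_compact; first exact: continuous_subspaceT.
  exact: M_compact P.
exists N; split; rewrite ?num_real // => y Ny x _.
by apply: mrt => //; exists x.
Qed.

Lemma ccont_cintegrable (f : M -> C) : (forall x, ccont x f) -> cintegrable f.
Proof. by move=> cf; split; apply: continuous_integrable => x; case: (cf x). Qed.

Let rintD (f g : M -> R) : rint f -> rint g -> rint (fun x => f x + g x).
Proof. by move=> hf hg; exact: (integrableD _ hf hg). Qed.

Let rintZ (c : R) (f : M -> R) : rint f -> rint (fun x => c * f x).
Proof. by move=> hf; exact: (integrableZl _ c hf). Qed.

Lemma cintegrable_lin c f g : cintegrable f -> cintegrable g ->
  cintegrable (fun x => c * f x + g x).
Proof.
move=> [f1 f2] [g1 g2]; split.
  under eq_fun do rewrite cReD cReM -mulNr.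
  by apply: rintD => //; apply: rintD; exact: rintZ.
under eq_fun do rewrite cImD cImM.
by apply: rintD => //; apply: rintD; exact: rintZ.
Qed.

Lemma cint_lin c f g : cintegrable f -> cintegrable g ->
  cint P (fun x => c * f x + g x) = c * cint P f + cint P g.
Proof.
move=> [f1 f2] [g1 g2]; apply/eqP; rewrite eq_complex.
apply/andP; split; apply/eqP.
  rewrite cReD cReM /=; under eq_Rintegral do rewrite cReD cReM -mulNr.
  rewrite !RintegralD // ?RintegralZl // ?mulNr //; try exact: rintZ.
  by apply: rintD; exact: rintZ.
rewrite cImD cImM /=; under eq_Rintegral do rewrite cImD cImM.
rewrite !RintegralD // ?RintegralZl //; try exact: rintZ.
by apply: rintD; exact: rintZ.
Qed.

Lemma cintegrable0 : cintegrable (fun=> 0).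
Proof. by apply: ccont_cintegrable => x; exact: ccont_cst. Qed.

Lemma cint0 : cint P (fun=> 0) = 0.
Proof.
have := cint_lin (-1) cintegrable0 cintegrable0.
by rewrite mulr0 addr0 mulN1r addNr.
Qed.

Lemma cintegrable_sum (I : Type) (r : seq I) (c : I -> C) (f : I -> M -> C) :
  (forall i, cintegrable (f i)) ->
  cintegrable (fun x => \sum_(i <- r) c i * f i x).
Proof.
move=> fi; elim: r => [|i r IH].
  by under eq_fun do rewrite big_nil; exact: cintegrable0.
by under eq_fun do rewrite big_cons; exact: cintegrable_lin.
Qed.

Lemma cint_sum (I : Type) (r : seq I) (c : I -> C) (f : I -> M -> C) :
  (forall i, cintegrable (f i)) ->
  cint P (fun x => \sum_(i <- r) c i * f i x) =
  \sum_(i <- r) c i * cint P (f i).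
Proof.
move=> fi; elim: r => [|i r IH].
  by under eq_fun do rewrite big_nil; rewrite big_nil cint0.
under eq_fun do rewrite big_cons.
by rewrite big_cons cint_lin // ?IH //; exact: cintegrable_sum.
Qed.

End Integration.

(** * Reproducing kernels *)

Section HermitianBundles.
Context {R : realType} {n : nat} {M : ptopologicalType} {P : prequantum R n M}.
Local Notation C := R[i].
Local Notation herm L := (@hm R n M P L).
Implicit Types (L : hbundle P).

(** The first clause, which makes [hm] antilinear in its first argument, has
   the form in which [cdot] uses it: the expansion of a vector in the standard
   frame. *)
Definition sesquilinear L : Prop := forall y,
  (forall v w, herm L y v w = \sum_q conjc (v q) * herm L y (delta_fr q) w) /\
  (forall v c w1 w2,
     herm L y v (c *: w1 + w2) = c * herm L y v w1 + herm L y v w2).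

Definition hintegrable L (s1 s2 : section L) : Prop :=
  cintegrable P (fun x => herm L x (s1 x) (s2 x)).

Section Sesqui.
Variables (L : hbundle P) (Lsq : sesquilinear L).

Lemma hm_sumr y v (I : Type) (r : seq I) (c : I -> C) w :
  herm L y v (\sum_(i <- r) c i *: w i) = \sum_(i <- r) c i * herm L y v (w i).
Proof.
have [_ lin] := Lsq y; elim/big_rec2: _ => [|i a b _ <-]; last exact: lin.
by have := lin v (-1) 0 0; rewrite scaler0 addr0 mulN1r addNr.
Qed.

Lemma hm_suml y (I : Type) (r : seq I) (c : I -> C) v w :
  herm L y (\sum_(i <- r) c i *: v i) w =
  \sum_(i <- r) conjc (c i) * herm L y (v i) w.
Proof.
have [lin _] := Lsq y; rewrite lin.
under eq_bigr => q _.
  rewrite sum_ffunE rmorph_sum mulr_suml.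
  under eq_bigr do rewrite !ffunE rmorphM -mulrA. over.
rewrite exchange_big; apply: eq_bigr => i _ /=.
by rewrite lin mulr_sumr.
Qed.

Lemma hintegrable_span (d : nat) (e : 'I_d -> section L) s1 s2 :
  (forall j l, hintegrable (e j) (e l)) -> lspan e s1 -> lspan e s2 ->
  hintegrable s1 s2.
Proof.
move=> he [c1 E1] [c2 E2]; rewrite /hintegrable.
under eq_fun do rewrite E1 E2 hm_suml.
apply: cintegrable_sum => j; under eq_fun do rewrite hm_sumr.
by apply: cintegrable_sum => l; exact: he.
Qed.

(** The kernel of the operator theta_j |-> sigma_j, if theta is orthonormal. *)
Definition kernel_of (d : nat) (sigma theta : 'I_d -> section L) : hkernel L :=
  fun x y => \sum_j ctens (sigma j x) (theta j y).

Lemma cdot_kernel_of (d : nat) (sigma theta : 'I_d -> section L) x y w p :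
  cdot y (kernel_of sigma theta x y) w p =
  \sum_j sigma j x p * herm L y (theta j y) w.
Proof.
rewrite ffunE; have [lin _] := Lsq y.
under eq_bigr => q _.
  rewrite sum_ffunE rmorph_sum mulr_suml.
  under eq_bigr do rewrite !ffunE rmorphM /= conjcK -mulrA. over.
by rewrite exchange_big; apply: eq_bigr => j _ /=; rewrite -mulr_sumr -lin.
Qed.

(** By orthonormality only the terms h(theta_j, theta_j) contribute;
   integrability is what allows the integral to be computed term by term. *)
Lemma kernel_of_reproduces (d : nat) (sigma theta : 'I_d -> section L)
    (c : 'I_d -> C) s x :
  orthonormal theta -> (forall j l, hintegrable (theta j) (theta l)) ->
  (forall y, s y = \sum_l c l *: theta l y) ->
  [ffun p => cint P (fun y => cdot y (kernel_of sigma theta x y) (s y) p)] =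
  \sum_l c l *: sigma l x.
Proof.
move=> on ti Es; apply/ffunP=> p; rewrite ffunE sum_ffunE.
under eq_fun => y.
  rewrite cdot_kernel_of Es; under eq_bigr do rewrite hm_sumr. over.
rewrite cint_sum => [|j]; last by apply: cintegrable_sum => l; exact: ti.
apply: eq_bigr => j _; rewrite cint_sum => [|l]; last exact: ti.
rewrite ffunE /GRing.scale /= mulrC; congr (_ * _).
under eq_bigr do rewrite [cint _ _]on.
rewrite (bigD1 j) //= eqxx mulr1 big1 ?addr0 // => l /negPf lj.
by rewrite eq_sym lj mulr0.
Qed.

(** The second factors are expanded on the basis; the coefficients go to the
   first factors, where they get conjugated. *)
Lemma polarized_kernel_of (H : set (section L)) (d : nat)
    (theta : 'I_d -> section L) K :
  H = lspan theta -> polarized H K ->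
  exists sigma, K = kernel_of sigma theta.
Proof.
move=> -> [N [c [s1 [s2 [_ Hs2 EK]]]]].
have /choice[b Eb] : forall l, exists b : 'I_d -> C,
    forall y, s2 l y = \sum_j b j *: theta j y.
  exact: Hs2.
exists (fun j x => \sum_l conjc (c l * b l j) *: s1 l x).
apply/funext=> x; apply/funext=> y; rewrite EK /kernel_of.
apply/ffunP=> -[p q]; rewrite !sum_ffunE.
under eq_bigr => l _.
  rewrite !ffunE Eb sum_ffunE /GRing.scale /= !mulr_sumr. over.
rewrite exchange_big; apply: eq_bigr => j _.
rewrite !ffunE /= sum_ffunE rmorph_sum mulr_suml; apply: eq_bigr => l _.
rewrite !ffunE /GRing.scale /= rmorphM /= conjcK -!mulrA.
congr (_ * _); by rewrite mulrCA.
Qed.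

Lemma lspan_mem (d : nat) (theta : 'I_d -> section L) j : lspan theta (theta j).
Proof.
exists (fun l => (l == j)%:R) => x.
rewrite (bigD1 j) //= eqxx scale1r big1 ?addr0 //.
by move=> l /negPf->; rewrite scale0r.
Qed.

(** Uniqueness holds because sigma_l is the image of theta_l under the operator
   of kernel [kernel_of sigma theta], which is theta_l if this kernel is
   reproducing. *)
Lemma basis_kernel_reproducing (H : set (section L)) (d : nat)
    (theta : 'I_d -> section L) :
  orthonormal_basis H theta ->
  (forall s1 s2, H s1 -> H s2 -> hintegrable s1 s2) ->
  [/\ polarized H (basis_kernel theta),
      reproducing H (basis_kernel theta) &
      forall K : hkernel L,
        polarized H K -> reproducing H K -> K = basis_kernel theta].
Proof.
move=> [on HE] Hi.
have Hth j : H (theta j) by rewrite HE; exact: lspan_mem.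
have ti j l : hintegrable (theta j) (theta l) by exact: Hi.
split.
- exists d, (fun=> 1), theta, theta; split=> // x y.
  by apply: eq_bigr => j _; rewrite scale1r.
- move=> s; rewrite HE => -[c Es] x.
  rewrite -[basis_kernel theta]/(kernel_of theta theta).
  by rewrite (kernel_of_reproduces _ _ on ti Es).
move=> K /(polarized_kernel_of HE)[sigma ->] rep.
suff -> : sigma = theta by [].
apply/funext=> l; apply/funext=> x.
rewrite -(rep _ (Hth l)).
rewrite (kernel_of_reproduces (c := fun j => (j == l)%:R) _ _ on ti).
  rewrite (bigD1 l) //= eqxx scale1r big1 ?addr0 // => j /negPf->.
  by rewrite scale0r.
move=> y; rewrite (bigD1 l) //= eqxx scale1r big1 ?addr0 // => j /negPf->.
by rewrite scale0r.
Qed.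

End Sesqui.

End HermitianBundles.

(** * The Hermitian structures of the two bundles *)

Section Quantizations.
Context {R : realType} {n : nat} {M : ptopologicalType} {P : prequantum R n M}.
Local Notation C := R[i].
Local Notation herm L := (@hm R n M P L).

Lemma line_bundle_sesquilinear k : sesquilinear (line_bundle P k).
Proof.
move=> y; split=> [v w|v c w1 w2] /=.
  rewrite (bigD1 tt) //= big1 ?addr0 => [|[] //].
  by rewrite !ffunE eqxx rmorph1 mul1r.
by rewrite !ffunE mulrDr mulrCA.
Qed.

Lemma spinor_bundle_sesquilinear k : sesquilinear (spinor_bundle P k).
Proof.
move=> y; split=> [v w|v c w1 w2] /=; last by rewrite linearP.
rewrite -hform_suml; congr hform; apply/ffunP=> S.
rewrite sum_ffunE (bigD1 S) //= big1 ?addr0 => [|T TS].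
  by rewrite !ffunE eqxx /GRing.scale /= mulr1.
by rewrite !ffunE eq_sym (negPf TS) scaler0.
Qed.

Lemma conjc_mul_unit (z : C) : `|z| = 1 -> conjc z * z = 1.
Proof. by move=> z1; rewrite mulrC -[LHS]normCK z1 expr1n. Qed.

Lemma tr_expJ (k : nat) i j x (w z : C) : dom i x -> dom j x ->
  conjc (tr (p:=P) i j x ^+ k * w) * (tr (p:=P) i j x ^+ k * z) = conjc w * z.
Proof.
move=> ix jx; rewrite rmorphM /= mulrACA conjc_mul_unit ?mul1r //.
by rewrite normrX tr_unitary // expr1n.
Qed.

Lemma smooth_section_ccont (L : hbundle P) (s : section L) i b x :
  smooth_section s -> dom i x -> ccont x (fun y => loc s i (cht i y) b).
Proof.
move=> [_ ss] ix; apply: (@ccont_comp _ _ _ (cht i) (fun u => loc s i u b)).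
  exact: cht_cont.
have ux : cod i (cht i x) by exists x.
by have [s1 s2] := ss i b; split; [apply: (s1 0%N).1 | apply: (s2 0%N).1].
Qed.

Lemma near_dom (i : idx P) x : dom i x -> \forall y \near x, dom i y.
Proof. by move=> ix; apply: open_nbhs_nbhs; split => //; exact: dom_open. Qed.

(** Near [x] the product is read in the single chart selected at [x], as the
   transition functions to the other selected frames are unitary. *)
Lemma line_bundle_herm_ccont k (s1 s2 : section (line_bundle P k)) x :
  smooth_section s1 -> smooth_section s2 ->
  ccont x (fun y => herm (line_bundle P k) y (s1 y) (s2 y)).
Proof.
move=> ss1 ss2; set i := pref P x; have ix := pref_dom P x : dom i x.
apply: (@ccont_near _ _ _ _ (fun y =>
    conjc (loc s1 i (cht i y) tt) * loc s2 i (cht i y) tt)).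
  near=> y; have iy : dom i y by near: y; exact: near_dom.
  rewrite /= chtK // !ffunE tr_expJ //; exact: pref_dom.
by apply: ccontM; [apply: ccontJ|]; exact: smooth_section_ccont.
Unshelve. all: by end_near. Qed.

Lemma met_unit (i : idx P) u : cod i u -> met i u \in unitmx.
Proof.
move=> cu; rewrite unitmx_mul om_nondeg //=.
have /mulmx1_unit[//] : acs i u *m (- acs i u) = 1%:M.
by rewrite mulmxN acs_sqr // opprK.
Qed.

Lemma met_tensor (i j : idx P) u : overlap i j u ->
  met j u = (jac i j u)^T *m met i (cht i (inv j u)) *m jac i j u.
Proof. by move=> o; rewrite /met (om_tensor o) -!mulmxA (acs_tensor o). Qed.

(** The inverse metric is a contravariant tensor. The Jacobian matrix can be
   inverted because the metric is nondegenerate. *)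
Lemma imet_tensor (i j : idx P) x : dom i x -> dom j x ->
  imet i (cht i x) =
  jac i j (cht j x) *m imet j (cht j x) *m (jac i j (cht j x))^T.
Proof.
move=> ix jx.
have ui : met i (cht i x) \in unitmx by apply: met_unit; exists x.
have uj : met j (cht j x) \in unitmx by apply: met_unit; exists x.
have E : met j (cht j x) =
    (jac i j (cht j x))^T *m met i (cht i x) *m jac i j (cht j x).
  by rewrite (@met_tensor i) ?chtK //; exists x.
rewrite /imet; set D := jac _ _ _ in E *.
set g := met i _ in ui E *; set g' := met j _ in uj E *.
have Du : D \in unitmx by move: uj; rewrite E unitmx_mul => /andP[].
have XgD : D *m invmx g' *m D^T *m g *m D = D.
  by rewrite -3!mulmxA [D^T *m _]mulmxA -E mulVmx // mulmx1.
by rewrite -[RHS](mulmxK ui) -[_ *m g](mulmxK Du) XgD mulmxV // mul1mx.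
Qed.

Lemma mxCE p q (X : 'M[R]_(p, q)) : mxC X = map_mx (real_complex R) X.
Proof. by []. Qed.

Lemma loc_spinor_cht k (s : section (spinor_bundle P k)) (i : idx P) x :
  dom i x -> loc s i (cht i x) =
  tr (p := P) i (pref P x) x ^+ k *:
    pull (mxC (jac (pref P x) i (cht i x))) (s x).
Proof. by move=> ix; rewrite /= (chtK ix). Qed.

(** The frame selected at [x] may be replaced by that of any chart around [x]:
   the factor by which the twist changes is unitary, and the product of forms
   is invariant under the change of coordinates. *)
Lemma spinor_herm_local k (s1 s2 : section (spinor_bundle P k)) i x : dom i x ->
  herm (spinor_bundle P k) x (s1 x) (s2 x) =
  hform (mxC (imet i (cht i x))) (loc s1 i (cht i x)) (loc s2 i (cht i x)).
Proof.
move=> ix; have jx := pref_dom P x.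
rewrite (loc_spinor_cht s1 ix).
rewrite (loc_spinor_cht s2 ix).
set D := jac (pref P x) i (cht i x).
set t := tr i (pref P x) x ^+ k.
have tt1 : conjc t * t = 1.
  by apply: conjc_mul_unit; rewrite normrX tr_unitary // expr1n.
rewrite (hform_unit (mxC (imet i (cht i x))) _ _ tt1).
have Dr : map_mx conjc (mxC D) = mxC D.
  by apply/matrixP=> p q; rewrite !mxE conjc_real.
rewrite (hform_pull (mxC (imet i (cht i x))) _ _ Dr).
have -> : mxC D *m mxC (imet i (cht i x)) *m (mxC D)^T =
    mxC (imet (pref P x) (cht (pref P x) x)).
  by rewrite (imet_tensor jx ix) !mxCE !map_mxM map_trmx.
by [].
Qed.

Lemma spinor_bundle_herm_ccont k (s1 s2 : section (spinor_bundle P k)) x :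
  smooth_section s1 -> smooth_section s2 ->
  ccont x (fun y => herm (spinor_bundle P k) y (s1 y) (s2 y)).
Proof.
move=> ss1 ss2; set i := pref P x; have ix := pref_dom P x : dom i x.
apply: (@ccont_near _ _ _ _ (fun y => hform (mxC (imet i (cht i y)))
   (loc s1 i (cht i y)) (loc s2 i (cht i y)))).
  by near=> y; apply: spinor_herm_local; near: y; exact: near_dom.
apply: ccont_hform => [a b|S|S]; try exact: smooth_section_ccont.
have mc (f : idx P -> 'rV[R]_n.*2 -> 'M[R]_n.*2) :
    (forall i a b, smooth_on (cod i) (fun u => f i u a b)) ->
    forall a b, ccont x (fun y => mxC (f i (cht i y)) a b).
  move=> fs a' b'.
  apply: (@ccont_comp _ _ _ (cht i) (fun u => mxC (f i u) a' b')).
    exact: cht_cont.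
  have ux : cod i (cht i x) by exists x.
  under eq_fun do rewrite mxE; split => /=; last exact: cst_continuous.
  exact: (fs i a' b' 0%N).1.
have E y : mxC (imet i (cht i y)) =
    invmx (mxC (om i (cht i y)) *m mxC (acs i (cht i y))).
  by rewrite !mxCE -map_mxM -map_invmx.
under eq_fun do rewrite E.
apply: ccont_invmx.
  near=> y; rewrite !mxCE -map_mxM map_unitmx; apply: met_unit.
  by exists y => //; near: y; exact: near_dom.
apply: ccont_mulmx; first exact: mc (@om_smooth _ _ _ P).
exact: mc (@acs_smooth _ _ _ P).
Unshelve. all: by end_near. Qed.

(** * The three quantizations *)

(** In the almost Kaehler case only the generating eigensections are smooth by
   assumption, so integrability is extended from them by sesquilinearity. *)
Lemma quantization_hintegrable k d a c (L : hbundle P) (H : set (section L)) :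
  quantization k d a c H ->
  sesquilinear L /\ forall s1 s2, H s1 -> H s2 -> hintegrable s1 s2.
Proof.
case=> [_ _|e [_ [lam [es _ _ _]]]|_ _].
- split; first exact: line_bundle_sesquilinear.
  move=> s1 s2 [ss1 _] [ss2 _]; apply: ccont_cintegrable => x.
  exact: line_bundle_herm_ccont.
- split; first exact: line_bundle_sesquilinear.
  move=> s1 s2; apply: hintegrable_span; first exact: line_bundle_sesquilinear.
  move=> j l; apply: ccont_cintegrable => x.
  by apply: line_bundle_herm_ccont; [case: (es j)|case: (es l)].
split; first exact: spinor_bundle_sesquilinear.
move=> s1 s2 [ss1 _ _] [ss2 _ _]; apply: ccont_cintegrable => x.
exact: spinor_bundle_herm_ccont.
Qed.

End Quantizations.

Theorem theorem3p2 (R : realType) (n : nat) (M : ptopologicalType)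
    (P : prequantum R n M) (k d : nat) (a c : R)
    (Hd : is_riemann_roch_number P k d) (Ha : 0 < a)
    (L : hbundle P) (H : set (section L)) (HQ : quantization k d a c H)
    (theta : 'I_d -> section L) (Htheta : orthonormal_basis H theta) :
  [/\ polarized H (basis_kernel theta),
      reproducing H (basis_kernel theta) &
      forall K : hkernel L,
        polarized H K -> reproducing H K -> K = basis_kernel theta].
Proof.
have [Lsq Hi] := quantization_hintegrable HQ.
exact: basis_kernel_reproducing.
Qed.
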